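(* Let $\mathcal{C}$ be a compact closed category. If $\mathcal{C}$ has finite products, or if $\mathcal{C}$ has finite coproducts, then $\mathcal{C}$ has finite biproducts.
   Context: A compact closed category is a symmetric monoidal category $(\mathcal{C},\otimes,I)$ in which every object has a dual (in the sense of Kelly and Laplaza). Finite products include the nullary product (a terminal object $1$), and finite coproducts include the nullary coproduct (an initial object $0$). For a morphism $f: A+B\to C\times D$ in a category with finite products and coproducts, with product projections $\pi_1,\pi_2$ and coproduct injections $i_1,i_2$, write $f=\begin{bmatrix} f_{11} & f_{12}\\ f_{21} & f_{22}\end{bmatrix}$, where $f_{jk}=\pi_j\circ f\circ i_k$; $f$ is uniquely determined by these four maps, and any four maps $f_{11}:A\to C$, $f_{12}:B\to C$, $f_{21}:A\to D$, $f_{22}:B\to D$ arise in this way. A category $\mathcal{C}$ has finite biproducts if it has finite products and finite coproducts, such that: (i) the unique morphism $0\to 1$ is invertible, so that there is a zero map $0_{A,B}: A\to 1\cong 0\to B$ between any objects $A$ and $B$; and (ii) the morphism $\begin{bmatrix} 1_A & 0_{B,A}\\ 0_{A,B} & 1_B\end{bmatrix}: A+B\to A\times B$ is invertible for all objects $A$ and $B$ of $\mathcal{C}$. *)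

(* Defs.v *)
From mathcomp Require Import all_boot.

Set Implicit Arguments.
Unset Strict Implicit.
Unset Printing Implicit Defensive.

Declare Scope cat_scope.
Delimit Scope cat_scope with cat.
Local Open Scope cat_scope.

Reserved Notation "g ∘ f" (at level 40, left associativity).
Reserved Notation "A ⊗ B" (at level 35, right associativity).
Reserved Notation "f ⊠ g" (at level 35, right associativity).

Record category := Category {
  object :> Type;
  hom : object -> object -> Type;
  idm : forall A, hom A A;
  compose : forall A B D, hom B D -> hom A B -> hom A D
    where "g ∘ f" := (compose g f);
  compose_idl : forall A B (f : hom A B), idm B ∘ f = f;
  compose_idr : forall A B (f : hom A B), f ∘ idm A = f;
  composeA : forall A B D E (h : hom D E) (g : hom B D) (f : hom A B),
    h ∘ (g ∘ f) = h ∘ g ∘ f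
}.

Arguments hom {C} A B : rename.
Arguments idm {C} A : rename.
Arguments compose {C A B D} g f : rename.

Notation "g ∘ f" := (compose g f) : cat_scope.

Definition inverse (C : category) (A B : C) (f : hom A B) (g : hom B A) : Prop :=
  g ∘ f = idm A /\ f ∘ g = idm B.

Definition invertible (C : category) (A B : C) (f : hom A B) : Prop :=
  exists g : hom B A, inverse f g.

Record iso (C : category) (A B : C) := Iso {
  fwd : hom A B;
  bwd : hom B A;
  iso_inverse : inverse fwd bwd
}.

Record product (C : category) (I : Type) (F : I -> C) := Product {
  prod_obj :> C;
  proj : forall i, hom prod_obj (F i);
  into_prod : forall X, (forall i, hom X (F i)) -> hom X prod_obj;
  into_prodP : forall X (f : forall i, hom X (F i)) i,
    proj i ∘ into_prod f = f i;
  into_prod_unique : forall X (f : forall i, hom X (F i)) (h : hom X prod_obj),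
    (forall i, proj i ∘ h = f i) -> h = into_prod f
}.

Record coproduct (C : category) (I : Type) (F : I -> C) := Coproduct {
  coprod_obj :> C;
  inj : forall i, hom (F i) coprod_obj;
  from_coprod : forall X, (forall i, hom (F i) X) -> hom coprod_obj X;
  from_coprodP : forall X (f : forall i, hom (F i) X) i,
    from_coprod f ∘ inj i = f i;
  from_coprod_unique : forall X (f : forall i, hom (F i) X) (h : hom coprod_obj X),
    (forall i, h ∘ inj i = f i) -> h = from_coprod f
}.

Definition has_finite_products (C : category) : Prop :=
  forall (I : finType) (F : I -> C), inhabited (product F).

Definition has_finite_coproducts (C : category) : Prop :=
  forall (I : finType) (F : I -> C), inhabited (coproduct F).

Definition terminal (C : category) := product (of_void C).
Definition initial (C : category) := coproduct (of_void C).

Definition to_terminal (C : category) (T : terminal C) (A : C) : hom A T :=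
  into_prod T (fun v => match v with end).
Definition from_initial (C : category) (Z : initial C) (A : C) : hom Z A :=
  from_coprod Z (fun v => match v with end).

(* The index [true] is the first factor (or summand), [false] the second. *)
Definition pair_family (C : category) (A B : C) (b : bool) : C :=
  if b then A else B.

Definition bin_product (C : category) (A B : C) := product (pair_family A B).
Definition bin_coproduct (C : category) (A B : C) := coproduct (pair_family A B).

Section Matrix.

Variables (C : category) (A B D E : C).
Variables (S : bin_coproduct A B) (P : bin_product D E).

Definition pi1 : hom P D := proj P true.
Definition pi2 : hom P E := proj P false.
Definition inj1 : hom A S := inj S true.
Definition inj2 : hom B S := inj S false.

Definition pairing (X : C) (f : hom X D) (g : hom X E) : hom X P :=
  into_prod P (fun b => match b return hom X (pair_family D E b) with
                        | true => f | false => g end).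

Definition copairing (X : C) (f : hom A X) (g : hom B X) : hom S X :=
  from_coprod S (fun b => match b return hom (pair_family A B b) X with
                          | true => f | false => g end).

Definition matrix (f11 : hom A D) (f12 : hom B D)
    (f21 : hom A E) (f22 : hom B E) : hom S P :=
  copairing (pairing f11 f21) (pairing f12 f22).

Lemma matrixP (f11 : hom A D) (f12 : hom B D) (f21 : hom A E) (f22 : hom B E)
    (f : hom S P) :
  [/\ pi1 ∘ f ∘ inj1 = f11, pi1 ∘ f ∘ inj2 = f12,
      pi2 ∘ f ∘ inj1 = f21 & pi2 ∘ f ∘ inj2 = f22]
  <-> f = matrix f11 f12 f21 f22.
Proof.
have pr1 X (g : hom X D) h : pi1 ∘ pairing g h = g.
  exact: (into_prodP _ _ true).
have pr2 X (g : hom X D) h : pi2 ∘ pairing g h = h.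
  exact: (into_prodP _ _ false).
have in1 X (g : hom A X) h : copairing g h ∘ inj1 = g.
  exact: (from_coprodP _ _ true).
have in2 X (g : hom A X) h : copairing g h ∘ inj2 = h.
  exact: (from_coprodP _ _ false).
split=> [[e11 e12 e21 e22]|->].
  by apply: from_coprod_unique; case; apply: into_prod_unique; case;
     rewrite composeA.
by rewrite -!composeA !in1 !in2 !pr1 !pr2.
Qed.

End Matrix.

(* The zero map A -> 1 -> 0 -> B, where k : 1 -> 0 is meant to be the inverse
   of the unique map 0 -> 1. *)
Definition zero_map (C : category) (T : terminal C) (Z : initial C)
    (k : hom T Z) (A B : C) : hom A B :=
  from_initial Z B ∘ k ∘ to_terminal T A.

(* The conditions are imposed on every choice of the products and coproducts
   involved; these exist by the first two clauses. *)
Definition has_finite_biproducts (C : category) : Prop :=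
  [/\ has_finite_products C,
      has_finite_coproducts C &
      forall (T : terminal C) (Z : initial C),
      exists2 k : hom T Z, inverse (from_initial Z T) k &
      forall (A B : C) (S : bin_coproduct A B) (P : bin_product A B),
        invertible (matrix S P (idm A)           (zero_map k B A)
                               (zero_map k A B)  (idm B))].

(* Only the triangle, the pentagon, one hexagon and the symmetry are required;
   the other usual coherence conditions follow. *)
Record symmetric_monoidal (C : category) := SymmetricMonoidal {
  unit_obj : C;
  tensor : C -> C -> C
    where "A ⊗ B" := (tensor A B);
  tensor_hom : forall A A' B B' : C,
    hom A A' -> hom B B' -> hom (A ⊗ B) (A' ⊗ B')
    where "f ⊠ g" := (tensor_hom f g);
  tensor_id : forall A B : C, idm A ⊠ idm B = idm (A ⊗ B);
  tensor_compose : forall (A A' A'' B B' B'' : C)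
      (f' : hom A' A'') (f : hom A A') (g' : hom B' B'') (g : hom B B'),
    (f' ∘ f) ⊠ (g' ∘ g) = (f' ⊠ g') ∘ (f ⊠ g);

  associator : forall A B D : C, iso ((A ⊗ B) ⊗ D) (A ⊗ (B ⊗ D));
  left_unitor : forall A : C, iso (unit_obj ⊗ A) A;
  right_unitor : forall A : C, iso (A ⊗ unit_obj) A;
  braiding : forall A B : C, hom (A ⊗ B) (B ⊗ A);

  associator_natural : forall (A A' B B' D D' : C)
      (f : hom A A') (g : hom B B') (h : hom D D'),
    fwd (associator A' B' D') ∘ ((f ⊠ g) ⊠ h)
      = (f ⊠ (g ⊠ h)) ∘ fwd (associator A B D);
  left_unitor_natural : forall (A A' : C) (f : hom A A'),
    fwd (left_unitor A') ∘ (idm unit_obj ⊠ f) = f ∘ fwd (left_unitor A);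
  right_unitor_natural : forall (A A' : C) (f : hom A A'),
    fwd (right_unitor A') ∘ (f ⊠ idm unit_obj) = f ∘ fwd (right_unitor A);
  braiding_natural : forall (A A' B B' : C) (f : hom A A') (g : hom B B'),
    braiding A' B' ∘ (f ⊠ g) = (g ⊠ f) ∘ braiding A B;

  triangle : forall A B : C,
    (idm A ⊠ fwd (left_unitor B)) ∘ fwd (associator A unit_obj B)
      = fwd (right_unitor A) ⊠ idm B;
  pentagon : forall A B D E : C,
    fwd (associator A B (D ⊗ E)) ∘ fwd (associator (A ⊗ B) D E)
      = (idm A ⊠ fwd (associator B D E)) ∘ fwd (associator A (B ⊗ D) E)
          ∘ (fwd (associator A B D) ⊠ idm E);
  hexagon : forall A B D : C,
    fwd (associator B D A) ∘ braiding A (B ⊗ D) ∘ fwd (associator A B D)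
      = (idm B ⊠ braiding A D) ∘ fwd (associator B A D)
          ∘ (braiding A B ⊠ idm D);
  symmetry : forall A B : C, braiding B A ∘ braiding A B = idm (A ⊗ B)
}.

Arguments tensor {C} M A B : rename.
Arguments tensor_hom {C} M {A A' B B'} f g : rename.
Arguments associator {C} M A B D : rename.
Arguments left_unitor {C} M A : rename.
Arguments right_unitor {C} M A : rename.
Arguments braiding {C} M A B : rename.

Section CompactClosed.

Variables (C : category) (M : symmetric_monoidal C).

Local Notation "A ⊗ B" := (tensor M A B).
Local Notation "f ⊠ g" := (tensor_hom M f g).
Local Notation one := (unit_obj M).

Definition is_dual (A A' : C)
    (eta : hom one (A' ⊗ A)) (eps : hom (A ⊗ A') one) : Prop :=
  fwd (left_unitor M A) ∘ (eps ⊠ idm A) ∘ bwd (associator M A A' A)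
      ∘ (idm A ⊠ eta) ∘ bwd (right_unitor M A) = idm A
  /\ fwd (right_unitor M A') ∘ (idm A' ⊠ eps) ∘ fwd (associator M A' A A')
      ∘ (eta ⊠ idm A') ∘ bwd (left_unitor M A') = idm A'.

Definition compact_closed : Prop :=
  forall A : C, exists (A' : C) (eta : hom one (A' ⊗ A)) (eps : hom (A ⊗ A') one),
    is_dual eta eps.

End CompactClosed.

(* Main.v *)
From Stdlib Require Import IndefiniteDescription.
From mathcomp Require Import all_boot.
Require Import Defs.

Set Implicit Arguments.
Unset Strict Implicit.
Unset Printing Implicit Defensive.

Local Open Scope cat_scope.

(** Why finite products and coproducts agree in a compact closed category.

    If [A'] is dual to [A], then [A ⊗ -] is left adjoint to [A' ⊗ -]
    ([dual_adjoint]), so [A ⊗ -] preserves coproducts.  The hypotheses are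
    self-dual in a strong sense: reversing both the arrows and the order of the
    tensor factors turns [C] into a compact closed category with the very same
    dual pairs ([op_rev], [op_rev_compact]).  Read in that category, the same
    adjunction says that [- ⊗ A] preserves products.

    Products give coproducts ([coproducts_of_products]).  Let [D i] be dual to
    [F i], let [P] be the product of the [D i] and let [Q] be dual to [P].
    Naturally in [Y], and with 1 denoting the tensor unit,

      hom (Q, Y) ≅ hom (1, P ⊗ Y) ≅ ∏ hom (1, D i ⊗ Y) ≅ ∏ hom (F i, Y),

    because [P ⊗ Y] is the product of the [D i ⊗ Y]; thus [Q] is the coproduct
    of the [F i].  The passage from coproducts to products is this argument in
    the opposite category.

    Given both, let [T] be terminal and [Z] initial.  Then [T ⊗ Z] is terminal
    because [T] is, and initial because [Z] is, so [Z ≅ T ⊗ Z ≅ T].  For the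
    matrix map from [A + B] to [A × B], consider the object
    [(A × B) ⊗ (1 + 1)].  It is at once a coproduct of two copies of
    [(A × B) ⊗ 1] and the product of [A ⊗ (1 + 1)] and [B ⊗ (1 + 1)].  Being a
    product, it receives a map from [A × B], and being a coproduct, it has a
    map to [A + B]; the composite of the two is the inverse of the matrix map
    ([diagonal_invertible]). *)

(** * Universal properties and opposite categories *)

Lemma prod_ext (C : category) (I : Type) (F : I -> C) (P : product F) (X : C)
    (f g : hom X P) :
  (forall i, proj P i ∘ f = proj P i ∘ g) -> f = g.
Proof.
by move=> fg; rewrite (into_prod_unique fg) -(into_prod_unique (fun=> erefl)).
Qed.

Lemma coprod_ext (C : category) (I : Type) (F : I -> C) (S : coproduct F)
    (X : C) (f g : hom S X) :
  (forall i, f ∘ inj S i = g ∘ inj S i) -> f = g.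
Proof.
by move=> fg; rewrite (from_coprod_unique fg) -(from_coprod_unique (fun=> erefl)).
Qed.

Lemma empty_prod_ext (C : category) (F : void -> C) (P : product F) (X : C)
    (f g : hom X P) :
  f = g.
Proof. by apply: prod_ext => -[]. Qed.

Lemma empty_coprod_ext (C : category) (F : void -> C) (S : coproduct F)
    (X : C) (f g : hom S X) :
  f = g.
Proof. by apply: coprod_ext => -[]. Qed.

Section Iso.

Variables (C : category) (A B : C) (u : iso A B).

Lemma bwdK : bwd u ∘ fwd u = idm A.
Proof. by case: (iso_inverse u). Qed.

Lemma fwdK : fwd u ∘ bwd u = idm B.
Proof. by case: (iso_inverse u). Qed.

Lemma fwd_inj (X : C) (f g : hom B X) : f ∘ fwd u = g ∘ fwd u -> f = g.
Proof.
by move/(congr1 (fun h => h ∘ bwd u)); rewrite -!composeA fwdK !compose_idr.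
Qed.

End Iso.

Lemma bwd_natural (C : category) (A A' B B' : C) (u : iso A B) (u' : iso A' B')
    (f : hom A A') (g : hom B B') :
  fwd u' ∘ f = g ∘ fwd u -> bwd u' ∘ g = f ∘ bwd u.
Proof.
move=> nat_f; apply: (fwd_inj (u := u)).
by rewrite -!composeA -nat_f composeA !bwdK compose_idl compose_idr.
Qed.

Definition op (C : category) : category :=
  @Category C (fun A B => hom B A) (@idm C) (fun _ _ _ g f => f ∘ g)
    (fun _ _ f => compose_idr f) (fun _ _ f => compose_idl f)
    (fun _ _ _ _ h g f => esym (composeA f g h)).

Section OppositeLimits.

Variables (C : category) (I : Type) (F : I -> C).

Definition op_product (S : coproduct F) : @product (op C) I F :=
  @Product (op C) I F S (inj S) (from_coprod S)
    (@from_coprodP _ _ _ S) (@from_coprod_unique _ _ _ S).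

Definition op_coproduct (P : product F) : @coproduct (op C) I F :=
  @Coproduct (op C) I F P (proj P) (into_prod P)
    (@into_prodP _ _ _ P) (@into_prod_unique _ _ _ P).

Definition unop_product (S : @coproduct (op C) I F) : product F :=
  @Product C I F S (inj S) (from_coprod S)
    (@from_coprodP _ _ _ S) (@from_coprod_unique _ _ _ S).

End OppositeLimits.

(** * Compact closed structures are self-dual *)

Section OppositeMonoidal.

Variables (C : category) (M : symmetric_monoidal C).

Local Notation "A ⊗ B" := (tensor M A B).
Local Notation "f ⊠ g" := (tensor_hom M f g).
Local Notation one := (unit_obj M).

Lemma op_inverse (A B : C) (u : iso A B) :
  @inverse (op C) B A (fwd u) (bwd u).
Proof. by split; [exact: (fwdK u) | exact: (bwdK u)]. Qed.

Lemma op_inverse_bwd (A B : C) (u : iso A B) :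
  @inverse (op C) A B (bwd u) (fwd u).
Proof. by split; [exact: (bwdK u) | exact: (fwdK u)]. Qed.

(** The order of the tensor factors is reversed together with the arrows so
    that the associators keep their direction: the pentagon, the hexagon and
    the snake equations then become themselves. *)
Definition op_rev : symmetric_monoidal (op C).
Proof.
refine (@SymmetricMonoidal (op C) one (fun A B => B ⊗ A)
  (fun _ _ _ _ f g => g ⊠ f) _ _
  (fun A B D => Iso (op_inverse (associator M D B A)))
  (fun A => Iso (op_inverse_bwd (right_unitor M A)))
  (fun A => Iso (op_inverse_bwd (left_unitor M A)))
  (fun A B => braiding M A B) _ _ _ _ _ _ _ _) => /=.
- by move=> A B; exact: tensor_id.
- by move=> *; exact: tensor_compose.
- by move=> *; exact/esym/associator_natural.
- by move=> *; exact/esym/bwd_natural/right_unitor_natural.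
- by move=> *; exact/esym/bwd_natural/left_unitor_natural.
- by move=> *; exact/esym/braiding_natural.
- move=> A B.
  change (fwd (associator M B one A) ∘ (bwd (right_unitor M B) ⊠ idm A)
          = idm B ⊠ bwd (left_unitor M A)).
  rewrite -[LHS]compose_idl -tensor_id -{1}(bwdK (left_unitor M A)).
  rewrite -{1}(compose_idl (idm B)) tensor_compose -!composeA.
  rewrite (composeA _ (associator _ _ _ _).(fwd)) triangle -tensor_compose.
  by rewrite fwdK compose_idl tensor_id compose_idr.
- by move=> A B D E; rewrite [LHS](pentagon M E D B A) -composeA.
- by move=> A B D; have := hexagon M A D B; rewrite -!composeA.
- by move=> A B; exact: symmetry.
Defined.

(** The unit and the counit of a dual pair exchange their roles, and each of
    the two snake equations is its own mirror image. *)
Lemma op_rev_compact : compact_closed M -> compact_closed op_rev.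
Proof.
move=> hC A; have [A' [eta [eps [snake1 snake2]]]] := hC A.
by exists A', eps, eta; move: snake1 snake2; rewrite -!composeA; split.
Qed.

End OppositeMonoidal.

(** * Tensoring with a dual pair *)

Section Duals.

Variables (C : category) (M : symmetric_monoidal C).

Local Notation "A ⊗ B" := (tensor M A B).
Local Notation "f ⊠ g" := (tensor_hom M f g).
Local Notation one := (unit_obj M).
Local Notation α := (associator M).
Local Notation λ := (left_unitor M).
Local Notation ρ := (right_unitor M).

Lemma tensor_compose1 (A B D E : C) (g : hom B D) (f : hom A B) :
  (g ∘ f) ⊠ idm E = (g ⊠ idm E) ∘ (f ⊠ idm E).
Proof. by rewrite -tensor_compose compose_idl. Qed.

Lemma tensor_1compose (A B D E : C) (g : hom B D) (f : hom A B) :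
  idm E ⊠ (g ∘ f) = (idm E ⊠ g) ∘ (idm E ⊠ f).
Proof. by rewrite -tensor_compose compose_idl. Qed.

Lemma unit_tensor_inj (A B : C) (f g : hom A B) :
  idm one ⊠ f = idm one ⊠ g -> f = g.
Proof.
move=> fg; apply: (fwd_inj (u := λ A)).
by rewrite -!left_unitor_natural fg.
Qed.

Lemma tensor_iso1_inverse (A B E : C) (u : iso A B) :
  inverse (fwd u ⊠ idm E) (bwd u ⊠ idm E).
Proof. by split; rewrite -tensor_compose1 ?bwdK ?fwdK tensor_id. Qed.

Definition tensor_iso1 (A B : C) (u : iso A B) (E : C) : iso (A ⊗ E) (B ⊗ E) :=
  Iso (tensor_iso1_inverse E u).

(** Kelly's redundancy argument: after tensoring with the unit on the left,
    which loses no information, the equation follows from the pentagon and two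
    triangles. *)
Lemma left_unitor_tensor (A B : C) :
  fwd (λ (A ⊗ B)) ∘ fwd (α one A B) = fwd (λ A) ⊠ idm B.
Proof.
apply: unit_tensor_inj; apply: (fwd_inj (u := α one (one ⊗ A) B)).
apply: (fwd_inj (u := tensor_iso1 (α one one A) B)) => /=.
rewrite -associator_natural -[RHS]composeA -tensor_compose1 triangle.
rewrite associator_natural tensor_id -triangle.
by rewrite -composeA -composeA pentagon !composeA -tensor_1compose.
Qed.

(** [A ⊗ -] is left adjoint to [B ⊗ -], as a natural bijection of hom-sets. *)
Record tensor_adjoint (A B : C) := TensorAdjoint {
  curry : forall X Y, hom (A ⊗ X) Y -> hom X (B ⊗ Y);
  uncurry : forall X Y, hom X (B ⊗ Y) -> hom (A ⊗ X) Y;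
  curryK : forall X Y (f : hom (A ⊗ X) Y), uncurry (curry f) = f;
  uncurryK : forall X Y (f : hom X (B ⊗ Y)), curry (uncurry f) = f;
  curry_naturalr : forall X Y Y' (g : hom Y Y') (f : hom (A ⊗ X) Y),
    curry (g ∘ f) = (idm B ⊠ g) ∘ curry f;
  curry_naturall : forall X X' Y (f : hom (A ⊗ X) Y) (h : hom X' X),
    curry (f ∘ (idm A ⊠ h)) = curry f ∘ h
}.

Section Adjunction.

Variables (A A' : C) (eta : hom one (A' ⊗ A)) (eps : hom (A ⊗ A') one).
Hypothesis dualA : is_dual eta eps.

Let counit Y : hom (A ⊗ (A' ⊗ Y)) Y :=
  fwd (λ Y) ∘ (eps ⊠ idm Y) ∘ bwd (α A A' Y).

Let unit X : hom X (A' ⊗ (A ⊗ X)) :=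
  fwd (α A' A X) ∘ (eta ⊠ idm X) ∘ bwd (λ X).

Let counit_natural Y Y' (g : hom Y Y') :
  counit Y' ∘ (idm A ⊠ (idm A' ⊠ g)) = g ∘ counit Y.
Proof.
have nat_α := bwd_natural (associator_natural M (idm A) (idm A') g).
rewrite /counit -composeA nat_α tensor_id !composeA -left_unitor_natural.
by rewrite -!(composeA (fwd (λ Y'))) -!tensor_compose !compose_idl !compose_idr.
Qed.

Let unit_natural X X' (h : hom X' X) :
  (idm A' ⊠ (idm A ⊠ h)) ∘ unit X' = unit X ∘ h.
Proof.
rewrite /unit !composeA -associator_natural tensor_id -!composeA.
rewrite (bwd_natural (left_unitor_natural M h)) !composeA.
by rewrite -!(composeA (fwd (α _ _ _))) -!tensor_compose !compose_idl !compose_idr.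
Qed.

Let counit_unit X : counit (A ⊗ X) ∘ (idm A ⊠ unit X) = idm (A ⊗ X).
Proof.
have pentagonV : bwd (α A A' (A ⊗ X)) ∘ (idm A ⊠ fwd (α A' A X))
    = fwd (α (A ⊗ A') A X) ∘ (bwd (α A A' A) ⊠ idm X) ∘ bwd (α A (A' ⊗ A) X).
  apply: (fwd_inj (u := α A (A' ⊗ A) X)).
  apply: (fwd_inj (u := tensor_iso1 (α A A' A) X)) => /=.
  rewrite -!composeA (composeA (idm A ⊠ _)) -pentagon.
  rewrite (composeA (bwd _)) bwdK compose_idl.
  rewrite (composeA (bwd (α A (A' ⊗ A) X))) bwdK compose_idl.
  by rewrite -tensor_compose1 bwdK tensor_id compose_idr.
have triangleV : bwd (α A one X) ∘ (idm A ⊠ bwd (λ X)) = bwd (ρ A) ⊠ idm X.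
  apply: (fwd_inj (u := tensor_iso1 (ρ A) X)) => /=.
  rewrite -[RHS]tensor_compose1 bwdK tensor_id -triangle.
  rewrite -composeA (composeA (idm A ⊠ _)) -tensor_1compose bwdK tensor_id.
  by rewrite compose_idl bwdK.
have eps_natural : fwd (λ (A ⊗ X)) ∘ (eps ⊠ idm (A ⊗ X)) ∘ fwd (α (A ⊗ A') A X)
    = (fwd (λ A) ∘ (eps ⊠ idm A)) ⊠ idm X.
  rewrite -composeA -tensor_id -associator_natural composeA left_unitor_tensor.
  by rewrite -tensor_compose1.
have eta_natural : bwd (α A (A' ⊗ A) X) ∘ (idm A ⊠ (eta ⊠ idm X))
    = ((idm A ⊠ eta) ⊠ idm X) ∘ bwd (α A one X).
  exact/bwd_natural/associator_natural.
have [snake _] := dualA.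
rewrite /counit /unit !tensor_1compose -!composeA (composeA (bwd (α _ _ _))) pentagonV.
rewrite -!composeA (composeA (bwd (α A (A' ⊗ A) X))) eta_natural.
rewrite -!composeA triangleV !composeA eps_natural.
by rewrite -!tensor_compose1 snake tensor_id.
Qed.

Let unit_counit Y : (idm A' ⊠ counit Y) ∘ unit (A' ⊗ Y) = idm (A' ⊗ Y).
Proof.
have pentagonV : (idm A' ⊠ bwd (α A A' Y)) ∘ fwd (α A' A (A' ⊗ Y))
    = fwd (α A' (A ⊗ A') Y) ∘ (fwd (α A' A A') ⊠ idm Y) ∘ bwd (α (A' ⊗ A) A' Y).
  apply: (fwd_inj (u := α (A' ⊗ A) A' Y)).
  rewrite -!composeA bwdK compose_idr pentagon -!composeA.
  by rewrite (composeA (idm A' ⊠ bwd _)) -tensor_1compose bwdK tensor_id compose_idl.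
have unitorV : bwd (α one A' Y) ∘ bwd (λ (A' ⊗ Y)) = bwd (λ A') ⊠ idm Y.
  apply: (fwd_inj (u := tensor_iso1 (λ A') Y)) => /=.
  rewrite -[RHS]tensor_compose1 bwdK tensor_id -left_unitor_tensor.
  by rewrite -composeA (composeA (bwd (λ _))) bwdK compose_idl bwdK.
have eps_natural : (idm A' ⊠ fwd (λ Y)) ∘ (idm A' ⊠ (eps ⊠ idm Y))
      ∘ fwd (α A' (A ⊗ A') Y)
    = (fwd (ρ A') ∘ (idm A' ⊠ eps)) ⊠ idm Y.
  by rewrite -composeA -associator_natural composeA triangle -tensor_compose1.
have eta_natural : bwd (α (A' ⊗ A) A' Y) ∘ (eta ⊠ idm (A' ⊗ Y))
    = ((eta ⊠ idm A') ⊠ idm Y) ∘ bwd (α one A' Y).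
  by rewrite -tensor_id; exact/bwd_natural/associator_natural.
have [_ snake] := dualA.
rewrite /counit /unit !tensor_1compose -!composeA.
rewrite (composeA (idm A' ⊠ bwd (α _ _ _))) pentagonV.
rewrite -!composeA (composeA (bwd (α (A' ⊗ A) A' Y))) eta_natural.
rewrite -!composeA unitorV !composeA eps_natural.
by rewrite -!tensor_compose1 snake tensor_id.
Qed.

(** The adjunction has the unit and counit of the dual pair, tensored with an
    arbitrary object; moving the brackets reduces its triangle identities to
    the snake equations tensored with that object. *)
Lemma dual_adjoint : tensor_adjoint A A'.
Proof.
refine (@TensorAdjoint A A' (fun X Y f => (idm A' ⊠ f) ∘ unit X)
  (fun X Y f => counit Y ∘ (idm A ⊠ f)) _ _ _ _) => /=.
- move=> X Y f; rewrite tensor_1compose composeA counit_natural -composeA.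
  by rewrite counit_unit compose_idr.
- move=> X Y f; rewrite tensor_1compose -composeA unit_natural composeA.
  by rewrite unit_counit compose_idl.
- by move=> X Y Y' g f; rewrite tensor_1compose composeA.
- by move=> X X' Y f h; rewrite tensor_1compose -composeA unit_natural composeA.
Qed.

End Adjunction.

Lemma uncurry_naturall (A B : C) (adj : tensor_adjoint A B) (X X' Y : C)
    (f : hom X (B ⊗ Y)) (h : hom X' X) :
  uncurry adj (f ∘ h) = uncurry adj f ∘ (idm A ⊠ h).
Proof. by rewrite -{1}(uncurryK adj f) -curry_naturall curryK. Qed.

Definition tensor_coproduct (A B : C) (adj : tensor_adjoint A B)
    (I : Type) (F : I -> C) (S : coproduct F) : coproduct (fun i => A ⊗ F i).
Proof.
refine (@Coproduct C I _ (A ⊗ S) (fun i => idm A ⊠ inj S i)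
  (fun X f => uncurry adj (from_coprod S (fun i => curry adj (f i)))) _ _).
- by move=> X f i; rewrite -uncurry_naturall from_coprodP curryK.
- move=> X f h hf; rewrite -[LHS](curryK adj); congr uncurry.
  by apply: from_coprod_unique => i; rewrite -curry_naturall hf.
Defined.

(** A coproduct carries its mediating maps into all objects as data, and the
    maps built below depend on the dual of their target; hence duals must be
    chosen for all objects at once. *)
Definition choose_adjoint (hC : compact_closed M) (A : C) :
  {B & tensor_adjoint A B}.
Proof.
have /constructive_indefinite_description[] // :
  exists _ : {B & tensor_adjoint A B}, True.
by have [A' [eta [eps /dual_adjoint adj]]] := hC A; exists (existT _ A' adj).
Qed.

End Duals.

(** Preservation of coproducts by [A ⊗ -], read in the reversed opposite
    category. *)
Definition tensor_product (C : category) (M : symmetric_monoidal C) (A B : C)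
    (adj : tensor_adjoint (op_rev M) A B) (I : Type) (F : I -> C)
    (P : product F) : product (fun i => tensor M (F i) A) :=
  unop_product (tensor_coproduct adj (op_coproduct P)).

(** * Coproducts from products, and conversely *)

Section Naming.

Variables (C : category) (M : symmetric_monoidal C).

Local Notation "A ⊗ B" := (tensor M A B).
Local Notation "f ⊠ g" := (tensor_hom M f g).
Local Notation one := (unit_obj M).
Local Notation λ := (left_unitor M).
Local Notation ρ := (right_unitor M).

(** A representation of the functor hom (1, B ⊗ -) by [A]: maps out of [A]
    correspond to their names, the global elements of the tensor with [B].
    Names trade maps out of a prospective coproduct for maps into a product. *)
Record naming (A B : C) := Naming {
  name : forall Y, hom A Y -> hom one (B ⊗ Y);
  unname : forall Y, hom one (B ⊗ Y) -> hom A Y;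
  nameK : forall Y (f : hom A Y), unname (name f) = f;
  unnameK : forall Y (f : hom one (B ⊗ Y)), name (unname f) = f;
  name_natural : forall Y Y' (g : hom Y Y') (f : hom A Y),
    name (g ∘ f) = (idm B ⊠ g) ∘ name f
}.

Definition naming_of_adjoint (A B : C) (adj : tensor_adjoint M A B) :
  naming A B.
Proof.
refine (@Naming A B (fun Y f => curry adj (f ∘ fwd (ρ A)))
  (fun Y f => uncurry adj f ∘ bwd (ρ A)) _ _ _).
- by move=> Y f; rewrite curryK -composeA fwdK compose_idr.
- by move=> Y f; rewrite -composeA bwdK compose_idr uncurryK.
- by move=> Y Y' g f; rewrite -composeA curry_naturalr.
Qed.

(** An object represents names in its dual by the adjunction itself; here the
    roles are exchanged, and the dual [A] of [B] represents names in [B].  This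
    is where the braiding enters, as a natural bijection between [Y ⊗ B] and
    [B ⊗ Y]. *)
Definition naming_of_op_adjoint (A B : C) (adj : tensor_adjoint (op_rev M) B A) :
  naming A B.
Proof.
pose transp Y : hom one (Y ⊗ B) -> hom (one ⊗ A) Y := @curry _ _ _ _ adj Y one.
pose untransp Y : hom (one ⊗ A) Y -> hom one (Y ⊗ B) := @uncurry _ _ _ _ adj Y one.
have transpK Y f : untransp Y (transp Y f) = f by exact: (curryK adj).
have untranspK Y f : transp Y (untransp Y f) = f by exact: (uncurryK adj).
have untransp_natural Y Y' (g : hom Y Y') f :
  untransp Y' (g ∘ f) = (g ⊠ idm B) ∘ untransp Y f.
  exact: (uncurry_naturall adj f g).
refine (@Naming A B (fun Y f => braiding M Y B ∘ untransp Y (f ∘ fwd (λ A)))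
  (fun Y f => transp Y (braiding M B Y ∘ f) ∘ bwd (λ A)) _ _ _).
- move=> Y f; rewrite composeA symmetry compose_idl untranspK.
  by rewrite -composeA fwdK compose_idr.
- move=> Y f; rewrite -composeA bwdK compose_idr transpK.
  by rewrite composeA symmetry compose_idl.
- move=> Y Y' g f; rewrite -composeA untransp_natural !composeA.
  by rewrite braiding_natural.
Qed.

(** A family of maps out of the [F i] is named by a single map into the product
    of the [D i ⊗ Y], which is [P ⊗ Y]; such a map is the name of a map out
    of [Q].  As in the Yoneda lemma, the injections come from the identity
    of [Q]. *)
Definition coproduct_of_naming (I : Type) (F D : I -> C) (P : product D) (Q : C)
    (adj : forall Y, {Y' & tensor_adjoint (op_rev M) Y Y'})
    (nF : forall i, naming (F i) (D i)) (nQ : naming Q P) : coproduct F.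
Proof.
pose PY Y := tensor_product (projT2 (adj Y)) P.
pose inQ i : hom (F i) Q := unname (nF i) ((proj P i ⊠ idm Q) ∘ name nQ (idm Q)).
have name_inQ i Y (h : hom Q Y) :
  name (nF i) (h ∘ inQ i) = (proj P i ⊠ idm Y) ∘ name nQ h.
  rewrite name_natural unnameK composeA -tensor_compose.
  rewrite -{2}[h]compose_idr name_natural composeA -tensor_compose.
  by rewrite !compose_idl !compose_idr.
refine (@Coproduct C I F Q inQ
  (fun Y f => unname nQ (into_prod (PY Y) (fun i => name (nF i) (f i)))) _ _).
- move=> Y f i; rewrite -[LHS](nameK (nF i)) name_inQ unnameK.
  by rewrite (into_prodP (PY Y)) nameK.
- move=> Y f h hf; rewrite -[LHS](nameK nQ); congr unname.
  by apply: (@into_prod_unique _ _ _ (PY Y)) => i; rewrite -hf name_inQ.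
Qed.

Lemma coproducts_of_products :
  compact_closed M -> has_finite_products C -> has_finite_coproducts C.
Proof.
move=> hC hP I F; have adjop := choose_adjoint (op_rev_compact hC).
pose D i := projT1 (choose_adjoint hC (F i)).
have nF i : naming (F i) (D i).
  exact: naming_of_adjoint (projT2 (choose_adjoint hC (F i))).
have [P] := hP I D; have [Q /naming_of_op_adjoint nQ] := adjop P.
by constructor; exact: coproduct_of_naming adjop nF nQ.
Qed.

End Naming.

Lemma products_of_coproducts (C : category) (M : symmetric_monoidal C) :
  compact_closed M -> has_finite_coproducts C -> has_finite_products C.
Proof.
move=> /op_rev_compact hCop hS I F.
have hPop : has_finite_products (op C).
  by move=> J G; have [S] := hS J G; constructor; exact: op_product S.
have [S] := coproducts_of_products hCop hPop F.
by constructor; exact: unop_product S.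
Qed.

(** * Products and coproducts coincide *)

Section Biproducts.

Variables (C : category) (M : symmetric_monoidal C).
Hypothesis hC : compact_closed M.

Local Notation "A ⊗ B" := (tensor M A B).
Local Notation "f ⊠ g" := (tensor_hom M f g).
Local Notation one := (unit_obj M).
Local Notation ρ := (right_unitor M).

Let adj := choose_adjoint hC.
Let adjop := choose_adjoint (op_rev_compact hC).

Lemma initial_tensor_ext (Z : initial C) (A X : C) (f g : hom (A ⊗ Z) X) : f = g.
Proof. exact: (empty_coprod_ext (S := tensor_coproduct (projT2 (adj A)) Z)). Qed.

Lemma terminal_tensor_ext (T : terminal C) (A X : C) (f g : hom X (T ⊗ A)) :
  f = g.
Proof. exact: (empty_prod_ext (P := tensor_product (projT2 (adjop A)) T)). Qed.

Variables (T : terminal C) (Z : initial C).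

(** [T ⊗ Z] is both terminal and initial, so [T → T ⊗ Z → Z] is the inverse. *)
Lemma from_initial_inverse : exists k : hom T Z, inverse (from_initial Z T) k.
Proof.
pose k1 : hom T (T ⊗ Z) :=
  into_prod (tensor_product (projT2 (adjop Z)) T) (fun v => match v with end).
pose k2 : hom (T ⊗ Z) Z :=
  from_coprod (tensor_coproduct (projT2 (adj T)) Z) (fun v => match v with end).
by exists (k2 ∘ k1); split; [exact: empty_coprod_ext | exact: empty_prod_ext].
Qed.

Variable k : hom T Z.

Local Notation zero A B := (zero_map k A B).

Lemma zero_compose (A B D : C) (f : hom A B) : zero B D ∘ f = zero A D.
Proof. by rewrite /zero_map -composeA; congr (_ ∘ _); exact: empty_prod_ext. Qed.

Lemma compose_zero (A B D : C) (f : hom B D) : f ∘ zero A B = zero A D.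
Proof.
by rewrite /zero_map !composeA; do 2!congr (_ ∘ _); exact: empty_coprod_ext.
Qed.

(** A zero map factors through [T], so its tensor with [f] factors through a
    terminal object, where it may be replaced by a zero map; dually
    [tensor_zero] uses the factorisation through [Z]. *)
Lemma zero_tensor (A B A' B' : C) (f : hom A' B') :
  zero A B ⊠ f = zero (A ⊗ A') (B ⊗ B').
Proof.
rewrite -(compose_zero (A ⊗ A') ((from_initial Z B ∘ k) ⊠ f)).
rewrite -{1}[f]compose_idr tensor_compose; congr (_ ∘ _).
exact: terminal_tensor_ext.
Qed.

Lemma tensor_zero (A B A' B' : C) (f : hom A' B') :
  f ⊠ zero A B = zero (A' ⊗ A) (B' ⊗ B).
Proof.
rewrite -(zero_compose (B' ⊗ B) (f ⊠ (k ∘ to_terminal T A))).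
rewrite -{1}[f]compose_idl /zero_map -composeA tensor_compose; congr (_ ∘ _).
exact: initial_tensor_ext.
Qed.

Section Diagonal.

Variables (I : eqType) (F : I -> C) (S : coproduct F) (P : product F).
Variables (K : coproduct (fun _ : I => one)) (m : hom S P).
Hypothesis m_diag : forall b, proj P b ∘ m ∘ inj S b = idm (F b).
Hypothesis m_offdiag : forall b c, b != c ->
  proj P b ∘ m ∘ inj S c = zero (F c) (F b).

(** The inverse passes through [P ⊗ K], whose product structure [PK] gives [u]
    out of [P] and whose coproduct structure [SP] gives [v] into [S].  The
    summands of [K] serve as tags for the indices: [u] tags the b-th component
    with [inj K b], and [v] reads the tag to select a component. *)
Lemma diagonal_invertible : invertible m.
Proof.
pose PK : product (fun b => F b ⊗ K) := tensor_product (projT2 (adjop K)) P.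
pose SP : coproduct (fun _ : I => P ⊗ one) :=
  tensor_coproduct (projT2 (adj P)) K.
have PKE b : proj PK b = proj P b ⊠ idm K by [].
have SPE b : inj SP b = idm P ⊠ inj K b by [].
pose u : hom P (P ⊗ K) :=
  into_prod PK (fun b => (idm (F b) ⊠ inj K b) ∘ bwd (ρ (F b)) ∘ proj P b).
pose v : hom (P ⊗ K) S :=
  from_coprod SP (fun b => inj S b ∘ proj P b ∘ fwd (ρ P)).
have uE b : (proj P b ⊠ idm K) ∘ u
    = (idm (F b) ⊠ inj K b) ∘ bwd (ρ (F b)) ∘ proj P b.
  exact: (into_prodP PK).
have vE b : v ∘ (idm P ⊠ inj K b) = inj S b ∘ proj P b ∘ fwd (ρ P).
  exact: (from_coprodP SP).
exists (v ∘ u); split.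
  apply: coprod_ext => b; rewrite compose_idl.
  (* Only the b-th component of [m ∘ inj S b] is nonzero, so [u] may as well
     tag every component with b. *)
  have um : u ∘ m ∘ inj S b = ((m ∘ inj S b) ⊠ inj K b) ∘ bwd (ρ (F b)).
    apply: (prod_ext (P := PK)) => c; rewrite PKE !composeA uE -tensor_compose.
    rewrite compose_idl -!composeA (composeA (proj P c)).
    have [<-|c_neq_b] := eqVneq c b; first by rewrite m_diag compose_idr.
    by rewrite m_offdiag // !compose_zero zero_tensor zero_compose.
  rewrite -!composeA (composeA u) um.
  rewrite -[m ∘ inj S b]compose_idl -[inj K b]compose_idr tensor_compose.
  rewrite !composeA vE -!composeA (composeA (fwd (ρ P))) right_unitor_natural.
  rewrite -!composeA fwdK compose_idr (composeA (proj P b)) m_diag.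
  exact: compose_idr.
apply: prod_ext => b; rewrite compose_idr.
(* [q] keeps the tag b and kills the others, as taking the b-th component of
   [m ∘ v] does. *)
pose q : hom K one :=
  from_coprod K (fun c => if b == c then idm one else zero one one).
have qE c : q ∘ inj K c = if b == c then idm one else zero one one.
  exact: (@from_coprodP _ _ _ K).
have mv : proj P b ∘ m ∘ v = fwd (ρ (F b)) ∘ (proj P b ⊠ q).
  apply: (coprod_ext (S := SP)) => c; rewrite SPE -!composeA vE -tensor_compose.
  rewrite compose_idr qE !composeA.
  have [<-|b_neq_c] := eqVneq b c.
    by rewrite m_diag compose_idl right_unitor_natural.
  by rewrite m_offdiag // tensor_zero !zero_compose compose_zero.
have qK : q ∘ inj K b = idm one by rewrite qE eqxx.
rewrite !composeA mv -[q]compose_idr -[proj P b]compose_idl tensor_compose.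
rewrite -!composeA uE !composeA -(composeA (fwd _)) -tensor_compose qK compose_idl.
by rewrite tensor_id compose_idr fwdK compose_idl.
Qed.

End Diagonal.

End Biproducts.

Theorem theorem1 (C : category) (M : symmetric_monoidal C) (hC : compact_closed M)
    (hprod : has_finite_products C \/ has_finite_coproducts C) :
  has_finite_biproducts C.
Proof.
have hP : has_finite_products C.
  by case: hprod => [//|]; exact: products_of_coproducts hC.
have hS : has_finite_coproducts C.
  by case: hprod => [|//]; exact: coproducts_of_products hC.
split=> // T Z; have [k kK] := from_initial_inverse hC T Z; exists k => // A B S P.
have [K] := hS bool (fun=> unit_obj M).
have [m11 m12 m21 m22] := (matrixP (idm A) (zero_map k B A) (zero_map k A B)
  (idm B) (matrix S P (idm A) (zero_map k B A) (zero_map k A B) (idm B))).2 erefl.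
by apply: (diagonal_invertible hC (k := k) K) => [[]|[] []].
Qed.
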